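(* Let $p$ be an odd prime, $m$ a positive even integer, $s=m/2$, $q=p^m$, $u$ a positive integer and $v=\gcd(m,u)$. Let $\mathrm{Tr}$ denote the trace map from $\mathbb{F}_q$ to $\mathbb{F}_p$. Let \[ D_1=\{(x,y)\in\mathbb{F}_q^2\setminus\{(0,0)\} : \mathrm{Tr}(x+y^{p^u+1})=0\}, \] and $C_{D_1}=\{c(a,b)=(\mathrm{Tr}(ax+by))_{(x,y)\in D_1} : a,b\in\mathbb{F}_q\}$. If $\frac{m}{v}\equiv 0\pmod 4$, then $C_{D_1}$ is a $[p^{2m-1}-1,2m]$ three-weight linear code over $\mathbb{F}_p$ whose weight distribution is: weight $0$ with multiplicity $1$; weight $(p-1)p^{2m-2}$ with multiplicity $p^{2m}-1-(p-1)p^{m-2v}$; weight $(p-1)p^{2m-2}\left(1+\frac{1}{p^{s-v}}\right)$ with multiplicity $(p-1)(p^{m-2v-1}-p^{s-v}+p^{s-v-1})$; and weight $(p-1)p^{2m-2}\left(1-\frac{1}{(p-1)p^{s-v}}\right)$ with multiplicity $(p-1)(p^{s-v}+1)(p^{s-v}-p^{s-v-1})$.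
   Context: An $[n,k]$ linear code over $\mathbb{F}_p$ is a $k$-dimensional subspace of $\mathbb{F}_p^n$. The multiplicity of a weight $w$ is the number of codewords of Hamming weight $w$; a code is $t$-weight if exactly $t$ nonzero weights occur. *)

(* Defs.v *)
From HB Require Import structures.
From mathcomp Require Import all_boot all_order all_algebra all_field.
Set Implicit Arguments. Unset Strict Implicit. Unset Printing Implicit Defensive.
Import GRing.Theory Num.Theory.
Local Open Scope ring_scope.

(* F plays the role of F_q, q = p^m, with char F = p.
   The prime field F_p is identified with the prime subfield of F,
   i.e. the image of the absolute trace. *)

Definition Tr {F : finFieldType} (p m : nat) (x : F) : F :=
  \sum_(i < m) x ^+ (p ^ i).

Definition D1 {F : finFieldType} (p m u : nat) : {set F * F} :=
  [set xy | (xy != (0, 0)) && (Tr p m (xy.1 + xy.2 ^+ (p ^ u + 1)) == 0)].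

(* The codeword c(a,b) = (Tr(ax+by))_{(x,y) in D1}, represented as a finite
   function on F*F that is extended by 0 outside the index set D1. *)
Definition cw {F : finFieldType} (p m u : nat) (a b : F) : {ffun F * F -> F} :=
  [ffun xy => if xy \in D1 p m u then Tr p m (a * xy.1 + b * xy.2) else 0].

Definition code (F : finFieldType) (p m u : nat) : {set {ffun F * F -> F}} :=
  [set cw p m u ab.1 ab.2 | ab : F * F].

Definition wt {F : finFieldType} (c : {ffun F * F -> F}) : nat :=
  #|[set xy | c xy != 0]|.

Definition mult (F : finFieldType) (p m u : nat) (w : rat) : nat :=
  #|[set c in code F p m u | (wt c)%:R == w]|.

(* Main.v *)
Require Import Defs.
From HB Require Import structures.
From mathcomp Require Import all_boot all_order all_algebra all_field.
From mathcomp Require Import cyclic zify ring.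
Set Implicit Arguments. Unset Strict Implicit. Unset Printing Implicit Defensive.
Import GRing.Theory Num.Theory.
Local Open Scope ring_scope.

(* Write Q(y) = Tr(y^(p^u + 1)), a quadratic form over Fp, with polar form
   Tr(x f(y)) where f(y) = y^(p^u) + y^(p^(-u)).
   - Solving Tr(x) = -Q(y) for x, the pair (a, b) has the generic weight unless a is
     a nonzero element of Fp; in that case the weight is governed by the number of y
     with Q(y) = Tr((b/a) y).  This number is generic unless b/a = f(y0) for some y0
     (the image of f is the orthogonal of its kernel), and then completing the square
     gives #{Q = Q(y0)}.
   - ker f is a line over the subfield of order p^(2v), because -1 is a
     (p^(2v) - 1)-th power when 4 divides m/v.
   - Elements of Fp* are (p^u + 1)-th powers, so the nonzero levels of Q all have the
     same cardinality.  Counting the pairs with Q(x) = Q(y) yields this cardinality up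
     to a sign, p^(m-1) +- p^(m/2+v-1), and since the (p^v + 1)-th roots of unity act
     freely on the level, it is divisible by p^v + 1: the sign must be +. *)

(** * Counting in finite types *)

Lemma card_eq_sum (T : finType) (P : pred T) :
  #|[set x | P x]| = (\sum_x (P x : nat))%N.
Proof.
rewrite -sum1dep_card big_mkcond; apply: eq_bigr => x _; by case: (P x).
Qed.

Lemma card_pair (S T : finType) (P : S -> T -> bool) :
  #|[set z : S * T | P z.1 z.2]| = (\sum_x #|[set y | P x y]|)%N.
Proof.
rewrite card_eq_sum -(pair_big xpredT xpredT (fun x y => P x y : nat)) /=.
by apply: eq_bigr => x _; rewrite card_eq_sum.
Qed.

Lemma card_pair_swap (S T : finType) (P : S -> T -> bool) :
  #|[set z : S * T | P z.1 z.2]| = (\sum_y #|[set x | P x y]|)%N.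
Proof.
rewrite card_pair; under eq_bigr do rewrite card_eq_sum.
by rewrite exchange_big; apply: eq_bigr => y _; rewrite card_eq_sum.
Qed.

Lemma card_bij (T : finType) (h : T -> T) (P : pred T) :
  injective h -> #|[set x | P (h x)]| = #|[set x | P x]|.
Proof.
move=> h_inj; rewrite -(card_imset _ h_inj); apply: eq_card => y.
have [g hK gK] := injF_bij h_inj.
apply/imsetP/idP => [[x /[!inE] Px ->]|]; first by [].
by rewrite inE => Py; exists (g y); rewrite ?inE gK.
Qed.

Lemma sum_card_fibers_in (S T : finType) (h : S -> T) (A : {set S}) (B : {set T}) :
  {in A, forall x, h x \in B} ->
  (\sum_(t in B) #|[set x in A | h x == t]|)%N = #|A|.
Proof.
move=> hB; rewrite -sum1_card [RHS](partition_big h (mem B)) //.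
by apply: eq_bigr => t _; rewrite -sum1dep_card.
Qed.

Lemma sum_card_fibers (S T : finType) (h : S -> T) (B : {set T}) :
  (forall x, h x \in B) -> (\sum_(t in B) #|[set x | h x == t]|)%N = #|S|.
Proof.
move=> hB; rewrite -cardsT -(sum_card_fibers_in (h := h) (B := B)) //.
by apply: eq_bigr => t _; apply: eq_card => x; rewrite !inE.
Qed.

(* A0 and A1 are the sizes of the zero and nonzero levels, B = p^(m-1), E the
   deviation and d = p^v + 1; the other sign A1 = B - E would force d %| 2. *)
Lemma level_arith (P B E d A0 A1 : nat) :
  (1 < P -> 2 < d -> A0 + P.-1 * A1 = P * B -> P * E ^ 2 = B * d.-1 ^ 2 ->
   A0 ^ 2 + P.-1 * A1 ^ 2 + d.-1 ^ 2 * B = d.-1 ^ 2 * (P * B) + P * B * B ->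
   d %| A1 -> d %| P * E + 1 -> P * B = 1 %[mod d] ->
   A1 = B + E /\ A0 + P.-1 * E = B)%N.
Proof.
case: P => // p1 p1_gt0 d_gt2 /= sumE EE momE dvdA dvdE pB.
have sqE : ((A1%:Z - B%:Z) ^+ 2 = E%:Z ^+ 2)%R.
  have p_neq0 : (p1%:Z * (p1%:Z + 1) != 0)%R.
    by rewrite mulf_neq0 //; move: p1_gt0; clear; lia.
  apply: (mulfI p_neq0).
  move/(congr1 Posz): EE; move/(congr1 Posz): momE; move/(congr1 Posz): sumE.
  rewrite -!mulnn !PoszM !PoszD !PoszM (intS p1).
  move: (Posz A0) (Posz A1) (Posz B) (Posz E) (Posz d.-1) (Posz p1).
  clear; move=> a0 a1 b e d q sumE momE EE.
  have a0E : a0 = (1 + q) * b - q * a1 by rewrite -sumE addrK.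
  (* The left side is the total squared deviation of the level sizes from their mean [b], so the
     second moment determines [(a1 - b) ^+ 2]. *)
  have -> : q * (q + 1) * (a1 - b) ^+ 2 =
      (a0 * a0 + q * (a1 * a1) + d * d * b) - d * d * b - (1 + q) * b * b.
    by rewrite a0E; ring.
  rewrite momE; have -> : q * (q + 1) * e ^+ 2 = q * ((1 + q) * (e * e)) by ring.
  by rewrite EE; ring.
have /eqP := sqE; rewrite eqf_sqr => /orP[/eqP AE|/eqP AE].
  have A1E : A1 = (B + E)%N by move: AE; clear; lia.
  by split=> //; move: sumE; rewrite A1E; clear; nia.
have AE' : (A1 + E = B)%N by move: AE; clear; lia.
have : (d %| 2)%N; last by move/dvdn_leq => /(_ isT); rewrite leqNgt d_gt2.
have dvdB : (d %| p1.+1 * B + 1)%N.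
  have -> : (p1.+1 * B + 1 = p1.+1 * A1 + (p1.+1 * E + 1))%N.
    by rewrite -AE'; clear; lia.
  by rewrite dvdn_add // dvdn_mull.
by move: dvdB; rewrite /dvdn -modnDml pB modnDml.
Qed.

(** * Roots of unity in a finite field *)

Section FiniteField.
Variable F : finFieldType.

Lemma expf_pred_card (x : F) : x != 0 -> x ^+ #|F|.-1 = 1.
Proof.
move=> x_neq0; apply: (mulfI x_neq0).
by rewrite -exprS prednK ?expf_card ?mulr1 // ltnW // finNzRing_gt1.
Qed.

(** The q - 1 nonzero elements are distinct roots of unity of order dividing q - 1, which in a field
    forces one of them to be primitive. *)
Lemma finField_prim_root : exists z : F, (#|F|.-1).-primitive_root z.
Proof.
have q_gt1 := finNzRing_gt1 F.
have n_gt0 : (0 < #|F|.-1)%N by rewrite -ltnS prednK // ltnW.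
have /hasP[z _ zP] : has (#|F|.-1).-primitive_root (enum [set~ (0 : F)]).
  apply: has_prim_root => //; rewrite ?enum_uniq -?cardE ?cardsC1 //.
  apply/allP => x; rewrite mem_enum !inE => x_neq0.
  by rewrite unity_rootE expf_pred_card.
by exists z.
Qed.

Lemma card_unity_roots d :
  (0 < d)%N -> (d %| #|F|.-1)%N -> #|[set x : F | x ^+ d == 1]| = d.
Proof.
move=> d_gt0 dvd_d; have [z zP] := finField_prim_root.
have /(_ d dvd_d) := dvdn_prim_root zP; set y := z ^+ _ => yP.
have -> : [set x : F | x ^+ d == 1] = [set y ^+ (i : 'I_d) | i : 'I_d].
  apply/setP => x; rewrite inE; apply/eqP/imsetP => [/(prim_rootP yP)[i ->]|].
    by exists i.
  by case=> i _ ->; rewrite -exprM mulnC exprM (prim_expr_order yP) expr1n.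
rewrite card_imset ?card_ord // => i j /eqP.
by rewrite (eq_prim_root_expr yP) !modn_small // => /eqP/val_inj.
Qed.

(* A generator to the power (q - 1) / 2d; its d-th power is the square root of
   1 distinct from 1. *)
Lemma exists_root_opp1 d :
  (0 < d)%N -> (2 * d %| #|F|.-1)%N -> exists w : F, w ^+ d = -1.
Proof.
move=> d_gt0 dvd_d; have [z zP] := finField_prim_root.
have /(_ _ dvd_d) := dvdn_prim_root zP; set y := z ^+ _ => yP.
exists y; have /eqP : (y ^+ d) ^+ 2 = 1.
  by rewrite -exprM mulnC (prim_expr_order yP).
rewrite sqrf_eq1 => /orP[|/eqP//].
by rewrite -(prim_order_dvd yP) -{2}[d]mul1n dvdn_pmul2r.
Qed.

End FiniteField.

(** * Frobenius powers, the prime field and the trace *)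

Section Trace.
Variables (F : finFieldType) (p m : nat).
Hypotheses (pr_p : prime p) (charF : p \in [pchar F]).
Hypotheses (cardF : #|F| = (p ^ m)%N) (m_gt0 : (0 < m)%N).

Let expp_gt1 k : (0 < k)%N -> (1 < p ^ k)%N.
Proof. by move=> k_gt0; rewrite -(exp1n k) ltn_exp2r ?prime_gt1. Qed.

Let pmE : (p ^ m = p * p ^ m.-1)%N.
Proof. by rewrite -expnS prednK. Qed.

Implicit Types a b e w x y z t : F.

Let p_gt0 : (0 < p)%N := prime_gt0 pr_p.
Let p_gt1 : (1 < p)%N := prime_gt1 pr_p.

Lemma exprpD n x y : (x + y) ^+ (p ^ n) = x ^+ (p ^ n) + y ^+ (p ^ n).
Proof.
apply: exprDn_pchar.
by rewrite pnatX (eq_pnat _ (pcharf_eq charF)) pnat_id.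
Qed.

Lemma exprpN n x : (- x) ^+ (p ^ n) = - x ^+ (p ^ n).
Proof.
apply/eqP; rewrite -addr_eq0 -exprpD addNr expr0n.
by rewrite expn_eq0 gtn_eqF.
Qed.

Lemma exprpB n x y : (x - y) ^+ (p ^ n) = x ^+ (p ^ n) - y ^+ (p ^ n).
Proof. by rewrite exprpD exprpN. Qed.

Lemma exprp_inj n : injective (fun x : F => x ^+ (p ^ n)).
Proof.
move=> x y /eqP; rewrite -subr_eq0 -exprpB expf_eq0 subr_eq0.
by case/andP=> _ /eqP.
Qed.

Lemma exprp_mul_m k x : x ^+ (p ^ (m * k)) = x.
Proof.
by elim: k => [|k IH]; rewrite ?muln0 // mulnS expnD exprM -cardF expf_card.
Qed.

Definition Fp : {set F} := [set t | t ^+ p == t].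

Lemma FpP t : reflect (t ^+ p = t) (t \in Fp).
Proof. by rewrite inE; apply: eqP. Qed.

Lemma Fp_expp n t : t \in Fp -> t ^+ (p ^ n) = t.
Proof.
move/FpP => tP; elim: n => // n IH.
by rewrite expnS exprM tP IH.
Qed.

Lemma Fp0 : 0 \in Fp.
Proof. by rewrite inE expr0n gtn_eqF. Qed.

Lemma Fp1 : 1 \in Fp.
Proof. by rewrite inE expr1n. Qed.

Lemma FpD t t' : t \in Fp -> t' \in Fp -> t + t' \in Fp.
Proof.
by move=> /FpP tP /FpP tP'; apply/FpP; rewrite -[p]expn1 exprpD !expn1 tP tP'.
Qed.

Lemma FpN t : t \in Fp -> - t \in Fp.
Proof. by move=> /FpP tP; apply/FpP; rewrite -[p]expn1 exprpN !expn1 tP. Qed.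

Lemma FpB t t' : t \in Fp -> t' \in Fp -> t - t' \in Fp.
Proof. by move=> tP tP'; rewrite FpD ?FpN. Qed.

Lemma FpM t t' : t \in Fp -> t' \in Fp -> t * t' \in Fp.
Proof. by move=> /FpP tP /FpP tP'; apply/FpP; rewrite exprMn tP tP'. Qed.

Lemma FpV t : t \in Fp -> t^-1 \in Fp.
Proof. by move=> /FpP tP; apply/FpP; rewrite exprVn tP. Qed.

(** The nonzero fixed points are the [(p ^ k).-1]-th roots of unity, and [(p ^ k).-1] divides q - 1
    because [k] divides [m]. *)
Lemma card_fixed_exprp k :
  (0 < k)%N -> (k %| m)%N -> #|[set x : F | x ^+ (p ^ k) == x]| = (p ^ k)%N.
Proof.
move=> k_gt0 /dvdnP[j mE].
have pk_gt1 : (1 < p ^ k)%N by apply: expp_gt1.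
have -> : [set x : F | x ^+ (p ^ k) == x] =
          0 |: [set x : F | x ^+ (p ^ k).-1 == 1].
  apply/setP => x; rewrite !inE; have [->|x_neq0] := eqVneq x 0.
    by rewrite expr0n gtn_eqF ?eqxx ?(ltnW pk_gt1).
  by rewrite -(inj_eq (mulfI x_neq0) _ 1) -exprS mulr1 prednK // ltnW.
rewrite cardsU1 inE expr0n card_unity_roots; last 2 first.
- by rewrite -ltnS prednK // ltnW.
- by rewrite cardF mE mulnC expnM dvdn_pred_predX.
rewrite gtn_eqF; last by rewrite -ltnS prednK // ltnW.
by rewrite eq_sym oner_eq0 add1n prednK // ltnW.
Qed.

Lemma card_Fp : #|Fp| = p.
Proof. by have := @card_fixed_exprp 1 isT (dvd1n m); rewrite expn1. Qed.

Local Notation Tr := (@Tr F p m).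

Lemma TrD : {morph Tr : x y / x + y}.
Proof.
move=> x y; rewrite /Defs.Tr -big_split /=.
by apply: eq_bigr => i _; rewrite exprpD.
Qed.

Lemma TrN : {morph Tr : x / - x}.
Proof. by move=> x; rewrite /Defs.Tr -sumrN; apply: eq_bigr => i _; rewrite exprpN. Qed.

Lemma TrB : {morph Tr : x y / x - y}.
Proof. by move=> x y; rewrite TrD TrN. Qed.

Lemma Tr0 : Tr 0 = 0.
Proof. by apply: big1 => i _; rewrite expr0n expn_eq0 gtn_eqF. Qed.

Lemma TrZ t x : t \in Fp -> Tr (t * x) = t * Tr x.
Proof.
move=> tP; rewrite /Defs.Tr mulr_sumr.
by apply: eq_bigr => i _; rewrite exprMn (Fp_expp _ tP).
Qed.

(** Frobenius permutes the summands of the trace cyclically, since [x ^+ (p ^ m)] is [x]. *)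
Lemma Tr_exprp n x : Tr (x ^+ (p ^ n)) = Tr x.
Proof.
elim: n => // n IH; rewrite expnSr exprM -[RHS]IH; move: (x ^+ _) => {IH}y.
rewrite /Defs.Tr; case: m m_gt0 cardF => // k _ cardFk.
rewrite big_ord_recr big_ord_recl /= addrC -exprM -expnS -cardFk expf_card.
by congr (_ + _); apply: eq_bigr => i _; rewrite -exprM -expnS.
Qed.

Lemma Tr_Fp x : Tr x \in Fp.
Proof.
apply/FpP; rewrite -[RHS](Tr_exprp 1) /Defs.Tr expn1.
have frobD y z : (y + z) ^+ p = y ^+ p + z ^+ p by rewrite -[p]expn1 exprpD.
have frob0 : (0 : F) ^+ p = 0 by rewrite expr0n gtn_eqF.
rewrite (big_morph _ frobD frob0); apply: eq_bigr => i _.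
by rewrite -!exprM mulnC.
Qed.

Lemma card_Tr t : t \in Fp -> #|[set x | Tr x == t]| = (p ^ m.-1)%N.
Proof.
(* Tr - t is a polynomial of degree p^(m-1), so each of the p fibers of Tr over
   Fp has at most p^(m-1) elements; they partition a set of size p^m. *)
have le_fiber t' : (#|[set x | Tr x == t']| <= p ^ m.-1)%N.
  pose P : {poly F} := \sum_(i < m) 'X^(p ^ i) - t'%:P.
  have szP : size P = (p ^ m.-1).+1.
    rewrite /P; case: m m_gt0 => // k _; rewrite big_ord_recr /= addrAC.
    rewrite addrC size_polyDl size_polyXn // ltnS; apply: leq_trans (size_polyD _ _) _.
    rewrite size_polyN geq_max (leq_trans (size_polyC_leq1 _)) ?expn_gt0 ?p_gt0 //.
    rewrite andbT; apply: leq_trans (size_sum _ _ _) _; apply/bigmax_leqP => i _.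
    by rewrite size_polyXn ltn_exp2l.
  have P_neq0 : P != 0 by rewrite -size_poly_eq0 szP.
  rewrite -ltnS -szP cardE; apply: max_poly_roots; rewrite ?enum_uniq //.
  apply/allP => x; rewrite mem_enum inE => /eqP xP.
  rewrite /root /P hornerD hornerN hornerC horner_sum subr_eq0 -xP /Defs.Tr.
  by apply/eqP; apply: eq_bigr => i _; rewrite hornerXn.
move=> tP; apply/eqP; rewrite eqn_leq le_fiber /=.
have := sum_card_fibers Tr_Fp; rewrite cardF.
rewrite (bigD1 t) //= => sumE.
have leS : (\sum_(t' in Fp | t' != t) #|[set x | Tr x == t']| <= p.-1 * p ^ m.-1)%N.
  apply: (@leq_trans (\sum_(t' in Fp | t' != t) p ^ m.-1)%N).
    by apply: leq_sum.
  rewrite sum_nat_cond_const -card_Fp (cardsD1 t Fp) tP leq_mul2r.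
  by rewrite (eq_leq (eq_card _)) ?orbT // => x; rewrite !inE andbC.
have pm_split : (p ^ m = p ^ m.-1 + p.-1 * p ^ m.-1)%N.
  by rewrite -mulSn prednK.
by rewrite -(leq_add2r (p.-1 * p ^ m.-1)) -pm_split -sumE leq_add2l.
Qed.

Lemma card_Tr_mul a t :
  a != 0 -> t \in Fp -> #|[set x | Tr (a * x) == t]| = (p ^ m.-1)%N.
Proof.
move=> a_neq0 tP; rewrite -(card_Tr tP).
exact: (card_bij (fun x => Tr x == t) (mulfI a_neq0)).
Qed.

(* Count incidences between the points (Tr x, Tr (a x)) of the plane Fp^2 and the
   p + 1 lines through (t1, t2). *)
Lemma card_Tr_pair a t1 t2 : a \notin Fp -> t1 \in Fp -> t2 \in Fp ->
  (p * #|[set x | (Tr x == t1) && (Tr (a * x) == t2)]%R|)%N = (p ^ m.-1)%N.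
Proof.
move=> aP t1P t2P; apply/eqP; rewrite -(eqn_add2r (p ^ m)); apply/eqP.
have -> : (p ^ m.-1 + p ^ m = #|[set x | Tr x == t1]| +
    \sum_(c in Fp) #|[set x | Tr ((a + c) * x) == t2 + c * t1]%R|)%N.
  rewrite card_Tr // (eq_bigr (fun=> (p ^ m.-1)%N)) => [|c cP].
    by rewrite sum_nat_const card_Fp -expnS prednK.
  rewrite card_Tr_mul ?FpD ?FpM //; apply: contraNneq aP => /eqP.
  by rewrite addr_eq0 => /eqP->; apply: FpN.
have {1}-> : (p ^ m = \sum_(x : F) 1)%N by rewrite -cardF -sum1_card; apply: eq_bigl.
rewrite !card_eq_sum big_distrr /= -big_split /=.
under [X in (_ + X)%N]eq_bigr => c _ do rewrite card_eq_sum.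
rewrite exchange_big -big_split /=; apply: eq_bigr => x _.
have lineE c : c \in Fp -> (Tr ((a + c) * x) == t2 + c * t1) =
    ((Tr (a * x) - t2) + c * (Tr x - t1) == 0).
  by move=> cP; rewrite mulrDl TrD (TrZ _ cP) -[LHS]subr_eq0 opprD addrACA -mulrBr.
rewrite (eq_bigr _ (fun c cP => congr1 nat_of_bool (lineE c cP))) => {lineE}.
rewrite -(subr_eq0 _ t1) -(subr_eq0 _ t2).
have XP : Tr x - t1 \in Fp by rewrite FpB ?Tr_Fp.
have YP : Tr (a * x) - t2 \in Fp by rewrite FpB ?Tr_Fp.
move: (_ - t1) (_ - t2) XP YP => X Y XP YP.
(* The point [(t1, t2)] itself, where [X = Y = 0], is on all [p + 1] lines. Any other point is on
   exactly one: the vertical line if [X = 0], otherwise the line with [c = - Y / X]. *)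
have [->|X_neq0] /= := eqVneq X 0.
  under eq_bigr do rewrite mulr0 addr0.
  by rewrite sum_nat_const card_Fp addnC.
rewrite muln0 !add0n (bigD1 (- Y / X)) ?FpM ?FpN ?FpV //=.
rewrite divfK // subrr eqxx big1 // => c /andP[_ c_neq].
by rewrite addrC addr_eq0 -[- Y](divfK X_neq0) (inj_eq (mulIf X_neq0)) (negPf c_neq).
Qed.

(** Translation by [t * e] carries the zero fiber of [g] onto the fiber over [t], so all [p] fibers
    have the same size. *)
Lemma card_fiber_shift (A : {set F}) (g : F -> F) e :
  {in A, forall x, g x \in Fp} ->
  {in Fp & A, forall t x, (t * e + x \in A) && (g (t * e + x) == t + g x)} ->
  (p * #|[set x in A | g x == 0]%R|)%N = #|A|.
Proof.
move=> gP shiftP; rewrite -(sum_card_fibers_in gP) -card_Fp -sum_nat_const.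
apply: eq_bigr => t tP.
rewrite -(card_bij (fun x => (x \in A) && (g x == t)) (addrI (t * e))).
apply: eq_card => x; rewrite !inE; have [xA|xA] /= := boolP (x \in A).
  have /andP[-> /eqP->] := shiftP _ _ tP xA.
  by rewrite /= -[X in _ = (_ == X)]addr0 (inj_eq (addrI t)).
apply/esym/negbTE; apply: contra xA => /andP[xA _].
by have /andP[] := shiftP _ _ (FpN tP) xA; rewrite mulNr addKr.
Qed.

(** * Quadratic forms with polar form Tr (x f(y)) *)

Section SelfAdjointMap.
Variable f : F -> F.
Hypothesis fD : {morph f : x y / x + y}.
Hypothesis fZ : forall t x, t \in Fp -> f (t * x) = t * f x.
Hypothesis f_adj : forall x y, Tr (x * f y) = Tr (y * f x).

Let K : {set F} := [set x | f x == 0].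

Let f0 : f 0 = 0.
Proof. by rewrite -[0](mul0r 0) fZ ?Fp0 // !mul0r. Qed.

(** Since [A] is stable under [K], each fiber of [f] on [A] is a full coset of [K]. *)
Lemma card_imset_kernel (A : {set F}) :
  {in A & K, forall x k, x + k \in A} -> (#|f @: A| * #|K| = #|A|)%N.
Proof.
move=> AK; rewrite -(@sum_card_fibers_in _ _ f A (f @: A)); last first.
  by move=> x xA; apply: imset_f.
rewrite -sum_nat_const; apply: eq_bigr => _ /imsetP[x xA ->].
rewrite -[RHS](card_bij _ (addrI x)); apply: eq_card => k.
rewrite !inE fD -[X in _ && (_ == X)]addr0 (inj_eq (addrI (f x))).
have [fk0|] := boolP (f k == 0); last by rewrite andbF.
by rewrite AK // inE.
Qed.

(** Self-adjointness puts the image of [f] inside the orthogonal of its kernel. Equality follows by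
    size: counting the pairs [(c', k)] with [Tr (c' * k) = 0] in two ways gives
    [#|Kperp| * #|K| <= p ^ m]. *)
Lemma mem_imset_orthogonal c :
  (forall k, f k = 0 -> Tr (c * k) = 0) -> c \in f @: [set: F].
Proof.
pose Kperp := [set c | [forall k in K, Tr (c * k) == 0]].
have KP k : reflect (f k = 0) (k \in K) by rewrite inE; apply: eqP.
move=> cP; have cK : c \in Kperp.
  by rewrite inE; apply/forall_inP => k /KP /cP ->.
suff -> : f @: [set: F] = Kperp by [].
have K0 : 0 \in K by apply/KP.
have K_gt0 : (0 < #|K|)%N by apply/card_gt0P; exists 0.
apply/eqP; rewrite eqEcard; apply/andP; split.
  apply/subsetP => _ /imsetP[y _ ->]; rewrite inE.
  by apply/forall_inP => k /KP fk; rewrite mulrC f_adj fk mulr0 Tr0.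
rewrite -(leq_pmul2r K_gt0) card_imset_kernel; last by move=> x k _ _; rewrite inE.
rewrite cardsT cardF.
have cntK c' : (p * #|[set k in K | Tr (c' * k) == 0]%R|)%N =
    (#|K| + (c' \in Kperp) * (p.-1 * #|K|))%N.
  case: (boolP (c' \in Kperp)); rewrite inE.
    move/forall_inP => c'P; rewrite mul1n -mulSn prednK //.
    congr (_ * _)%N; apply: eq_card => k; rewrite inE.
    by case: (boolP (k \in K)) => // /c'P ->.
  case/forall_inPn => e eK Tre; rewrite mul0n addn0.
  (* The scaling of [e] makes its pairing with [c'] equal to 1, so shifting by multiples of it runs
     through all trace values. *)
  apply: (@card_fiber_shift K _ ((Tr (c' * e))^-1 * e)).
    by move=> k _; apply: Tr_Fp.
  move=> t k tP /KP fk; have TP := FpV (Tr_Fp (c' * e)).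
  rewrite inE fD fZ // fZ // fk (KP _ eK) !mulr0 addr0 eqxx /=.
  by rewrite mulrDr TrD mulrCA (TrZ _ tP) mulrCA (TrZ _ TP) mulVf // mulr1.
(* After exchanging the sums, [k = 0] contributes [p ^ m] and every other [k] a hyperplane of size
   [p ^ m.-1]. *)
have : (\sum_c' p * #|[set k in K | Tr (c' * k) == 0]%R| =
        p * (p ^ m + #|K|.-1 * p ^ m.-1))%N.
  rewrite -big_distrr /=; congr (_ * _)%N.
  rewrite (eq_bigr
    (fun c' => \sum_(k in K) ((Tr (c' * k) == 0)%R : nat))%N); last first.
    move=> c' _; rewrite card_eq_sum [RHS]big_mkcond; apply: eq_bigr => k _.
    by case: (k \in K).
  rewrite exchange_big (bigD1 0) //=; congr (_ + _)%N.
    rewrite (eq_bigr (fun=> 1%N)) ?sum1_card // => c' _.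
    by rewrite mulr0 Tr0 eqxx.
  rewrite (eq_bigr (fun=> p ^ m.-1)%N) ?sum_nat_cond_const.
    congr (_ * _)%N; rewrite (cardsD1 0 K) K0 /=; apply: eq_card => k.
    by rewrite !inE andbC.
  move=> k /andP[_ k_neq0]; rewrite -(card_Tr_mul k_neq0 Fp0) card_eq_sum.
  by apply: eq_bigr => c' _; rewrite mulrC.
rewrite (eq_bigr _ (fun c' _ => cntK c')).
rewrite big_split /= sum_nat_const -big_distrl /= -card_eq_sum.
rewrite [#|[set _ in Kperp]|]cardsE cardF pmE.
have solve P k Q C : (1 < P -> 0 < k ->
    P * Q * k + C * (P.-1 * k) = P * (P * Q + k.-1 * Q) -> C * k <= P * Q)%N.
  case: P => [|[|P]] //; case: k => // k _ _ /= E.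
  by rewrite -(leq_pmul2l (ltn0Sn P)); lia.
exact: solve.
Qed.

Section QuadraticForm.
Variable Q : F -> F.
Hypothesis Q_Fp : forall x, Q x \in Fp.
Hypothesis QN : forall x, Q (- x) = Q x.
Hypothesis QD : forall x y, Q (x + y) = Q x + Q y + Tr (x * f y).
Hypothesis two_neq0 : (2%:R : F) != 0.

Definition level t := [set x | Q x == t].

Lemma quad0 : Q 0 = 0.
Proof.
have := QD 0 0; rewrite mul0r Tr0 !addr0 => /eqP.
by rewrite -subr_eq0 opprD addrA subrr sub0r oppr_eq0 => /eqP.
Qed.

(** Expanding [Q (- k + k)] gives [2 * Q k = 0], and the characteristic is odd. *)
Lemma quad_ker k : f k = 0 -> Q k = 0.
Proof.
move=> fk; have := QD (- k) k; rewrite addNr quad0 QN fk mulr0 Tr0 addr0.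
by rewrite -mulr2n -mulr_natl => /esym/eqP; rewrite mulf_eq0 (negPf two_neq0) => /eqP.
Qed.

Lemma quadDker x k : f k = 0 -> Q (x + k) = Q x.
Proof. by move=> fk; rewrite QD (quad_ker fk) fk mulr0 Tr0 !addr0. Qed.

(* Both sides count the pairs (x, x + w) with Q (x + w) = Q x. *)
Lemma level_second_moment :
  (\sum_(t in Fp) #|level t| ^ 2 + #|K| * p ^ m.-1 =
   #|K| * p ^ m + p ^ m * p ^ m.-1)%N.
Proof.
have -> : (\sum_(t in Fp) #|level t| ^ 2 = \sum_x #|level (Q x)|)%N.
  rewrite [RHS](partition_big Q (mem Fp)) //=; apply: eq_bigr => t _.
  rewrite (eq_bigr (fun=> #|level t|)) => [|x /eqP-> //].
  by rewrite sum_nat_cond_const mulnn.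
have -> : (\sum_x #|level (Q x)| = \sum_w #|[set x | Tr (x * f w) == - Q w]%R|)%N.
  under [RHS]eq_bigr => w _ do rewrite card_eq_sum.
  rewrite exchange_big /=; apply: eq_bigr => x _.
  rewrite -(card_bij _ (addrI x)) card_eq_sum; apply: eq_bigr => w _.
  congr (nat_of_bool _); rewrite QD -addrA -subr_eq0 addrAC subrr add0r.
  by rewrite addrC addr_eq0.
(* For fixed [w] the equation is affine in [x]: it always holds if [w] is in the kernel, where
   [Q w = 0], and otherwise cuts out one trace fiber. *)
have cntE w : #|[set x | Tr (x * f w) == - Q w]| =
    (if w \in K then p ^ m else p ^ m.-1)%N.
  case: ifPn; rewrite inE => fw.
    rewrite (eqP fw) (quad_ker (eqP fw)) -cardF -cardsT; apply: eq_card => x.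
    by rewrite !inE mulr0 Tr0 oppr0 eqxx.
  rewrite -(card_Tr_mul fw (FpN (Q_Fp w))).
  by apply: eq_card => x; rewrite !inE mulrC.
rewrite (eq_bigr _ (fun w _ => cntE w)) (bigID (mem K)) /=.
rewrite (eq_bigr (fun=> p ^ m)%N) => [|w ->] //.
rewrite [X in (_ + X + _)%N](eq_bigr (fun=> p ^ m.-1)%N) => [|w /negPf->] //.
rewrite sum_nat_const sum_nat_cond_const -addnA -mulnDl; congr (_ + _ * _)%N.
by rewrite -cardF -(cardsC K) addnC; congr (_ + _)%N.
Qed.

(** Completing the square turns the equation into [Q (x - x0) = Q x0]. *)
Lemma card_meet_level_image x0 :
  #|[set x | Q x == Tr (f x0 * x)]| = #|level (Q x0)|.
Proof.
rewrite -[RHS](card_bij (fun x => Q x == Q x0) (addIr (- x0))).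
apply: eq_card => x; rewrite !inE.
have -> : Q (x - x0) = Q x + Q x0 - Tr (f x0 * x).
  by rewrite QD QN -mulN1r fZ ?FpN ?Fp1 // mulN1r mulrN TrN mulrC.
by rewrite -subr_eq0 -[in RHS]subr_eq0 addrAC addrK.
Qed.

(** Some kernel element [e] has [Tr (c * e) != 0]. Translation along [e] leaves [Q] unchanged and
    moves [Tr (c * x)] through all of [Fp], so [Tr (c * x) - Q x] is equidistributed. *)
Lemma card_meet_level_notin_image c : c \notin f @: [set: F] ->
  #|[set x | Q x == Tr (c * x)]| = (p ^ m.-1)%N.
Proof.
move=> cP; have [/forallP kerP|] := boolP [forall k, (f k == 0) ==> (Tr (c * k) == 0)].
  case/negP: cP; apply: mem_imset_orthogonal => k /eqP fk.
  by apply/eqP; have /implyP := kerP k; apply.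
case/forallPn => e; rewrite negb_imply => /andP[/eqP fe Tre].
have TP := FpV (Tr_Fp (c * e)).
have := @card_fiber_shift [set: F] (fun x => Tr (c * x) - Q x) ((Tr (c * e))^-1 * e).
rewrite cardsT cardF pmE => H.
apply/eqP; rewrite -(eqn_pmul2l p_gt0) -H.
- by apply/eqP; congr (_ * _)%N; apply: eq_card => x; rewrite !inE subr_eq0 eq_sym.
- by move=> x _; rewrite FpB ?Tr_Fp.
move=> t x tP _; rewrite inE /= [_ * _ + x]addrC quadDker; last first.
  by rewrite fZ // fZ // fe !mulr0.
rewrite mulrDr TrD [c * (t * _)]mulrCA (TrZ _ tP) [c * (_ * e)]mulrCA (TrZ _ TP).
by rewrite mulVf // mulr1 [_ + t]addrC addrA.
Qed.

Lemma card_image_level (A : {set F}) :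
  (#|f @: [set x | Q x \in A]| * #|K| = #|[set x | Q x \in A]|)%N.
Proof.
apply: card_imset_kernel => x k; rewrite !inE => xA /eqP fk.
by rewrite quadDker.
Qed.

End QuadraticForm.
End SelfAdjointMap.

(** * The form Tr (y^(p^u + 1)) *)

Section PowerForm.
Variables u v k w : nat.
Hypotheses (p_odd : odd p) (v_gt0 : (0 < v)%N) (k_gt0 : (0 < k)%N).
(** These encode that [v] is the gcd of [m] and [u], with cofactors [4 * k] and [w], and that 4
    divides m/v. *)
Hypotheses (mE : m = (4 * k * v)%N) (uE : u = (w * v)%N).
Hypothesis (w_coprime : coprime w (4 * k)).

Let Q x := Tr (x ^+ (p ^ u + 1)).
(* The exponent (m - 1) u makes y |-> y^(p^((m-1)u)) the inverse of y |-> y^(p^u). *)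
Let f y := y ^+ (p ^ u) + y ^+ (p ^ (m.-1 * u)).

Let two_neq0 : (2%:R : F) != 0.
Proof.
rewrite -(dvdn_pcharf charF); apply/negP => /dvdn_leq -/(_ isT) p_le2.
have p2 : p = 2%N by apply/eqP; rewrite eqn_leq p_le2.
by move: p_odd; rewrite p2.
Qed.

Let w_odd : odd w.
Proof.
have : coprime w 2 by apply: coprime_dvdr w_coprime; apply: dvdn_mulr.
by rewrite coprime_sym coprime2n.
Qed.

Lemma exprp_inv y : (y ^+ (p ^ (m.-1 * u))) ^+ (p ^ u) = y.
Proof. by rewrite -exprM -expnD -mulSnr prednK // exprp_mul_m. Qed.

Lemma power_form_Fp x : Q x \in Fp.
Proof. exact: Tr_Fp. Qed.

Lemma power_formN x : Q (- x) = Q x.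
Proof. by rewrite /Q !addn1 !exprSr exprpN mulrNN. Qed.

Lemma power_formD x y : Q (x + y) = Q x + Q y + Tr (x * f y).
Proof.
(* The trace is unchanged when the term [x * y ^+ (p ^ (m.-1 * u))] is raised to the power [p ^ u],
   which undoes the inverse Frobenius on [y]. *)
have -> : Tr (x * f y) = Tr (x * y ^+ (p ^ u) + x ^+ (p ^ u) * y).
  by rewrite mulrDr !TrD -(Tr_exprp u (x * y ^+ (p ^ (_ * u)))) exprMn exprp_inv.
rewrite /Q -!TrD !addn1 !exprSr exprpD; congr (Tr _); ring.
Qed.

Lemma polarD : {morph f : x y / x + y}.
Proof. by move=> x y; rewrite /f !exprpD addrACA. Qed.

Lemma polarZ t x : t \in Fp -> f (t * x) = t * f x.
Proof. by move=> tP; rewrite /f !exprMn !(Fp_expp _ tP) mulrDr. Qed.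

(** Both sides equal [Q (x + y) - Q x - Q y]. *)
Lemma polar_adj x y : Tr (x * f y) = Tr (y * f x).
Proof.
apply: (addrI (Q x + Q y)); rewrite -power_formD addrC.
by rewrite power_formD [Q y + _]addrC.
Qed.

Lemma iter_exprp_opp n j x :
  x ^+ (p ^ n) = - x -> x ^+ (p ^ (n * j)) = (-1) ^+ j * x.
Proof.
move=> xP; elim: j => [|j IH]; first by rewrite muln0 mul1r.
rewrite mulnS expnD exprM xP exprpN IH exprS; ring.
Qed.

Lemma iter_exprp_fixed n j x :
  x ^+ (p ^ n) = x -> x ^+ (p ^ (n * j)) = x.
Proof.
move=> xP; elim: j => [|j IH]; first by rewrite muln0.
by rewrite mulnS expnD exprM xP.
Qed.

(** Every [x] is fixed by the [m]-th Frobenius power, so a Bezout relation replaces [2 * u] by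
    [gcdn (2 * u) m]. This is [2 * v] because [w] is coprime to [2 * k]. *)
Lemma fixed_exprp_gcd x : (x ^+ (p ^ (2 * u)) == x) = (x ^+ (p ^ (2 * v)) == x).
Proof.
apply/eqP/eqP => [xP|xP]; last by rewrite uE mulnCA mulnC iter_exprp_fixed.
have gcdE : gcdn (2 * u) m = (2 * v)%N.
  have -> : (2 * u = 2 * v * w)%N by rewrite uE; lia.
  have -> : (m = 2 * v * (2 * k))%N by rewrite mE; lia.
  rewrite -muln_gcdr (eqP (_ : coprime w (2 * k))) ?muln1 //.
  by apply: coprime_dvdr w_coprime; rewrite dvdn_pmul2r.
have u2_gt0 : (0 < 2 * u)%N.
  by rewrite uE !muln_gt0 v_gt0; case: (w) w_odd.
case: (egcdnP m u2_gt0) => a b abE _; rewrite gcdE in abE.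
rewrite -[in LHS](exprp_mul_m b x) mulnC -exprM -expnD -abE mulnC.
exact: iter_exprp_fixed.
Qed.

(** It suffices that twice [p^(2v) - 1] divides q - 1. Here q is a power of [p^(4v)], and
    [p^(4v) - 1] is [p^(2v) - 1] times the even number [p^(2v) + 1]. *)
Lemma exists_semifixed : exists2 z : F, z != 0 & z ^+ (p ^ (2 * v)) = - z.
Proof.
have V_gt1 : (1 < p ^ (2 * v))%N by apply: expp_gt1; rewrite muln_gt0.
have V1_gt0 : (0 < (p ^ (2 * v)).-1)%N by rewrite -ltnS prednK // ltnW.
have dvdV : (2 * (p ^ (2 * v)).-1 %| #|F|.-1)%N.
  have -> : #|F| = (((p ^ (2 * v)) ^ 2) ^ k)%N.
    by rewrite cardF mE -!expnM; congr (_ ^ _)%N; lia.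
  apply: dvdn_trans (dvdn_pred_predX _ k).
  rewrite (predn_exp _ 2) !big_ord_recl big_ord0 /= expn0 expn1 addn0 mulnC.
  by rewrite dvdn_pmul2l // dvdn2 oddD oddX p_odd orbT.
have [z zP] := exists_root_opp1 V1_gt0 dvdV.
exists z; last by rewrite -[(p ^ _)%N](prednK (ltnW V_gt1)) exprS zP mulrN1.
apply/eqP => z0; move: zP; rewrite z0 expr0n gtn_eqF // => /eqP.
by rewrite eq_sym oppr_eq0 oner_eq0.
Qed.

(** Raised to the power [p ^ u], the equation [f x = 0] becomes [x ^+ (p ^ (2 * u)) = - x]. As [w]
    is odd, [z] solves it too, and division by [z] leaves the fixed-point equation of the subfield
    of order [p^(2v)]. *)
Lemma card_polar_kernel : #|[set x | f x == 0]| = (p ^ (2 * v))%N.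
Proof.
have [z z_neq0 zP] := exists_semifixed.
have dvd2v : (2 * v %| m)%N by apply/dvdnP; exists (2 * k)%N; rewrite mE; lia.
rewrite -(card_fixed_exprp _ dvd2v) ?muln_gt0 //.
rewrite -(card_bij (fun x => f x == 0) (mulfI z_neq0)); apply: eq_card => x.
rewrite !inE -fixed_exprp_gcd -(inj_eq (@exprp_inj u)) expr0n expn_eq0 gtn_eqF //=.
rewrite /f exprpD exprp_inv -exprM -expnD addnn -mul2n exprMn addr_eq0.
have -> : z ^+ (p ^ (2 * u)) = - z.
  by rewrite uE mulnCA mulnC iter_exprp_opp // -signr_odd w_odd mulN1r.
by rewrite mulNr eqr_opp (inj_eq (mulfI z_neq0)).
Qed.


(** As [w] is odd, [u] is congruent to [v] modulo [2 * v]; on the subfield of order [p^(2v)] the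
    power [p ^ u + 1] is thus the norm to the subfield of order [p ^ v]. *)
Let norm_exponent x : x ^+ (p ^ (2 * v)) = x -> x ^+ (p ^ u + 1) = x ^+ (p ^ v + 1).
Proof.
move=> xP; rewrite !addn1 !exprSr; congr (_ * _).
have -> : u = (2 * v * w./2 + v)%N.
  by rewrite uE -{1}(odd_double_half w) w_odd -mul2n; lia.
by rewrite expnD exprM iter_exprp_fixed.
Qed.

Let V_pred : (p ^ (2 * v)).-1 = ((p ^ v).-1 * (p ^ v + 1))%N.
Proof. by rewrite mulnC expnM predn_exp !big_ord_recl big_ord0 /= addn0 addnC. Qed.

Let dvd_V_q : ((p ^ (2 * v)).-1 %| #|F|.-1)%N.
Proof.
rewrite cardF; have -> : m = (2 * v * (2 * k))%N by rewrite mE; lia.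
by rewrite (expnM p (2 * v)) dvdn_pred_predX.
Qed.

Let fixed_of_unity_root x : x ^+ (p ^ (2 * v)).-1 = 1 -> x ^+ (p ^ (2 * v)) = x.
Proof.
by move=> xP; rewrite -(@prednK (p ^ (2 * v))) ?expn_gt0 ?p_gt0 // exprS xP mulr1.
Qed.

Lemma Fp_is_norm c : c \in Fp -> c != 0 -> exists2 z, z != 0 & z ^+ (p ^ u + 1) = c.
Proof.
move=> cP c_neq0; have [g gP] := finField_prim_root F.
have cp1 : c ^+ p.-1 = 1.
  by apply: (mulfI c_neq0); rewrite -exprS prednK // mulr1; apply/FpP.
have p1_gt0 : (0 < p.-1)%N by rewrite -ltnS prednK.
have dvd_pV : ((p ^ v + 1) * p.-1 %| (p ^ (2 * v)).-1)%N.
  by rewrite V_pred mulnC; apply: dvdn_mul; rewrite ?dvdn_pred_predX.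
have [i cE] := prim_rootP gP (expf_pred_card c_neq0).
(* From [c ^+ p.-1 = 1], q - 1 divides [i * p.-1]; since [(p ^ v + 1) * p.-1] divides q - 1, the
   factor [p.-1] cancels. *)
have /dvdnP[j iE] : (p ^ v + 1 %| i)%N.
  rewrite -(dvdn_pmul2r p1_gt0); apply: dvdn_trans (dvdn_trans dvd_pV dvd_V_q) _.
  by rewrite (prim_order_dvd gP) exprM -cE cp1.
have zE : (g ^+ j) ^+ (p ^ v + 1) = c by rewrite -exprM -iE -cE.
exists (g ^+ j).
  by apply: contraNneq c_neq0 => z0; rewrite -zE z0 expr0n addn1.
(* The root found for the exponent [p ^ v + 1] lies in the subfield of order [p^(2v)], where both
   exponents agree. *)
rewrite norm_exponent //; apply: fixed_of_unity_root.
by have /dvdnP[l ->] := dvd_pV; rewrite mulnC !exprM zE cp1 expr1n.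
Qed.

(** Multiplication by [z] with [z ^+ (p ^ u + 1) = t] multiplies [Q] by [t]. *)
Lemma card_level_scale t : t \in Fp -> t != 0 -> #|level Q t| = #|level Q 1|.
Proof.
move=> tP t_neq0; have [z z_neq0 zE] := Fp_is_norm tP t_neq0.
rewrite /level -(card_bij (fun x => Q x == t) (mulfI z_neq0)).
apply: eq_card => x; rewrite !inE /Q exprMn zE TrZ //.
by rewrite -[X in _ == X]mulr1 (inj_eq (mulfI t_neq0)).
Qed.

(* The (p^v + 1)-th roots of unity act freely on every nonzero level of Q. *)
Lemma dvdn_card_level1 : (p ^ v + 1 %| #|level Q 1%R|)%N.
Proof.
pose h x := x ^+ (p ^ v + 1).
rewrite -(@sum_card_fibers_in _ _ h _ (h @: level Q 1)); last first.
  by move=> x xA; apply: imset_f.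
apply: dvdn_sum => _ /imsetP[x xA ->]; rewrite inE in xA.
have x_neq0 : x != 0.
  apply: contraTneq xA => ->; rewrite (quad0 power_formD) eq_sym.
  exact: oner_neq0.
have d_gt0 : (0 < p ^ v + 1)%N by rewrite addn1.
have d_dvd : (p ^ v + 1 %| #|F|.-1)%N.
  by apply: dvdn_trans dvd_V_q; rewrite V_pred dvdn_mull.
rewrite -{1}(card_unity_roots d_gt0 d_dvd).
(* The fiber through [x] is [x] times the group of roots of unity; such a root [z] also satisfies
   [z ^+ (p ^ u + 1) = 1], so it preserves [Q]. *)
suff -> : #|[set y in level Q 1 | h y == h x]| =
          #|[set z : F | z ^+ (p ^ v + 1) == 1]| by [].
rewrite -[LHS](card_bij _ (mulfI x_neq0)); apply: eq_card => z.
rewrite !inE /h exprMn -[X in _ && (_ == X)]mulr1 (inj_eq (mulfI _)); last first.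
  by rewrite expf_neq0.
have [zE|_] := eqVneq (z ^+ (p ^ v + 1)) 1; last by rewrite andbF.
rewrite andbT /Q exprMn (norm_exponent (x := z)) ?zE ?mulr1 //.
by apply: fixed_of_unity_root; rewrite V_pred mulnC exprM zE expr1n.
Qed.


Let M := (p ^ m.-1)%N.
(** This is [p^(m/2+v-1)], as [m = 4 * k * v]. *)
Let E := (p ^ ((2 * k + 1) * v).-1)%N.

(** Modulo [p ^ v + 1] the square of [p ^ v] is 1. Hence the even power [p * M] is 1 and the odd
    power [p * E] is -1, the congruences that [level_arith] needs to fix the sign. *)
Lemma card_levels :
  (#|level Q 1%R| = M + E /\ #|level Q 0%R| + p.-1 * E = M)%N.
Proof.
have kv_gt0 : (0 < (2 * k + 1) * v)%N by rewrite muln_gt0 addn1.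
have pE : (p * E = (p ^ v) ^ (2 * k + 1))%N.
  by rewrite /E -expnS prednK // mulnC expnM.
have V1 : (p ^ v) ^ 2 = 1 %[mod p ^ v + 1].
  rewrite -[((p ^ v) ^ 2)%N](@prednK ((p ^ v) ^ 2)) ?expn_gt0 ?p_gt0 // -add1n.
  by rewrite -expnM mulnC V_pred mulnC -modnDmr modnMr addn0.
have V2 j : ((p ^ v) ^ 2) ^ j = 1 %[mod p ^ v + 1].
  by rewrite -modnXm V1 modnXm exp1n.
apply: (@level_arith p M E (p ^ v + 1)); rewrite ?addn1 /= -?[(p ^ v).+1]addn1.
- exact: p_gt1.
- by have := expp_gt1 v_gt0; lia.
- have := sum_card_fibers power_form_Fp; rewrite (bigD1 0) ?Fp0 //= cardF pmE => <-.
  congr (_ + _)%N; rewrite (eq_bigr (fun=> #|level Q 1|)) => [|t /andP[tP t0]].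
    rewrite sum_nat_cond_const; congr (_ * _)%N; rewrite -card_Fp (cardsD1 0 Fp) Fp0.
    by apply: eq_card => t; rewrite !inE andbC.
  exact: card_level_scale.
- rewrite /M /E -!expnM -expnD -expnS; congr (_ ^ _)%N.
  have -> : ((2 * k + 1) * v = 2 * (k * v) + v)%N by rewrite mulnDl mul1n mulnA.
  have : (0 < k * v)%N by rewrite muln_gt0 k_gt0.
  by rewrite mE -mulnA; move: v_gt0; clear; move: (k * v)%N => kv; lia.
- have moment := level_second_moment power_form_Fp power_formN power_formD two_neq0.
  rewrite card_polar_kernel (bigD1 0) ?Fp0 //= [(2 * v)%N]mulnC expnM pmE in moment.
  rewrite -moment.
  congr (_ + _ + _)%N.
  rewrite (eq_bigr (fun=> #|level Q 1%R| ^ 2)%N) => [|t /andP[tP t0]].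
    rewrite sum_nat_cond_const; congr (_ * _)%N; rewrite -card_Fp (cardsD1 0 Fp) Fp0.
    by apply: eq_card => t; rewrite !inE andbC.
  by rewrite card_level_scale.
- exact: dvdn_card_level1.
- rewrite -[(p * E).+1]addn1 pE /dvdn expnD expn1 expnM -modnDml -modnMml V2.
  by rewrite modnMml mul1n modnDml modnn.
- rewrite -pmE mE; have -> : (4 * k * v = v * 2 * (2 * k))%N by lia.
  by rewrite (expnM p (v * 2)) (expnM p v) V2.
Qed.

(** * Weights of the codewords *)

(** The three nonzero weights in integral form: with s = m/2, [E] is [M] divided by [p^(s-v)]. *)
Let W0 := (p.-1 * M ^ 2)%N.
Let W1 := (p.-1 * M ^ 2 + p.-1 * E * M)%N.
Let W2 := (p.-1 * M ^ 2 - E * M)%N.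

(* Q (f^-1 (b / a)) is well defined; exceptional A collects the (a, b) for which it
   exists and lies in A. *)
Definition exceptional (A : {set F}) : {set F * F} :=
  [set ab | [&& ab.1 \in Fp, ab.1 != 0 & ab.2 / ab.1 \in f @: [set x | Q x \in A]]].

(* The positions of D1, together with (0, 0), where the codeword vanishes. *)
Let Z a b := #|[set xy : F * F |
  (Tr (xy.1 + xy.2 ^+ (p ^ u + 1)) == 0) && (Tr (a * xy.1 + b * xy.2) == 0)]|.

Let support_card :
  #|[set xy : F * F | Tr (xy.1 + xy.2 ^+ (p ^ u + 1)) == 0]| = (p * M ^ 2)%N.
Proof.
rewrite (card_pair_swap (fun x y => Tr (x + y ^+ (p ^ u + 1)) == 0)).
rewrite (eq_bigr (fun=> M)) => [|y _].
  by rewrite sum_nat_const cardF pmE -mulnA mulnn.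
rewrite /M -(card_Tr (FpN (power_form_Fp y))); apply: eq_card => x.
by rewrite !inE TrD addr_eq0.
Qed.

Lemma card_D1 : #|@D1 F p m u| = (p * M ^ 2).-1.
Proof.
rewrite -support_card [in RHS](cardsD1 (0, 0)) inE /= expr0n addn1 add0r Tr0 eqxx add1n.
by apply: eq_card => xy; rewrite !inE addn1.
Qed.

Let wtZ a b : (wt (cw p m u a b) + Z a b = p * M ^ 2)%N.
Proof.
rewrite -support_card /Z !card_eq_sum /wt card_eq_sum -big_split /=.
apply: eq_bigr => -[x y] _; rewrite ffunE inE /=.
(* The origin lies outside [D1], but both [Z] and the total count it. *)
have [[-> ->]|_] /= := eqVneq (x, y) (0, 0).
  by rewrite expr0n addn1 !mulr0 !add0r Tr0 eqxx.
by case: (Tr (x + _) == 0); rewrite ?eqxx //=; case: (_ == 0).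
Qed.

(** Once [Tr x = - Q y] is imposed, the second equation no longer involves [x], so each [y]
    contributes a whole trace fiber or nothing. *)
Let Z_row a b : a \in Fp ->
  Z a b = (M * #|[set y | a * Q y == Tr (b * y)]%R|)%N.
Proof.
move=> aP; rewrite /Z (card_pair_swap (fun x y =>
  (Tr (x + y ^+ (p ^ u + 1)) == 0) && (Tr (a * x + b * y) == 0))).
rewrite card_eq_sum mulnC big_distrl /=; apply: eq_bigr => y _.
have eqE x : (Tr (x + y ^+ (p ^ u + 1)) == 0) && (Tr (a * x + b * y) == 0) =
    (Tr x == - Q y) && (a * Q y == Tr (b * y)).
  rewrite TrD addr_eq0; case: eqP => //= TrxE.
  by rewrite TrD (TrZ _ aP) TrxE mulrN addrC subr_eq0 eq_sym.
rewrite (eq_card (B := [set x | (Tr x == - Q y) && (a * Q y == Tr (b * y))]));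
  last by move=> x; rewrite !inE eqE.
case: (_ == Tr _).
  rewrite mul1n /M -(card_Tr (FpN (power_form_Fp y))); apply: eq_card => x.
  by rewrite !inE andbT.
by rewrite mul0n; apply: eq_card0 => x; rewrite !inE andbF.
Qed.

(** For each [y] both [Tr x] and [Tr (a * x)] are prescribed, and these are jointly equidistributed
    when [a] is outside [Fp]. *)
Let Z_generic a b : a \notin Fp -> Z a b = (M ^ 2)%N.
Proof.
move=> aP; rewrite /Z (card_pair_swap (fun x y =>
  (Tr (x + y ^+ (p ^ u + 1)) == 0) && (Tr (a * x + b * y) == 0))).
apply/eqP; rewrite -(eqn_pmul2l p_gt0) big_distrr /=; apply/eqP.
rewrite (eq_bigr (fun=> M)) => [|y _].
  by rewrite sum_nat_const cardF pmE -mulnA mulnn.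
rewrite /M -(card_Tr_pair aP (FpN (power_form_Fp y)) (FpN (Tr_Fp (b * y)))).
by congr (_ * _)%N; apply: eq_card => x; rewrite !inE !TrD !addr_eq0.
Qed.

Let Z_scaled a b : a \in Fp -> a != 0 ->
  Z a b = (M * #|[set y | Q y == Tr (b / a * y)]%R|)%N.
Proof.
move=> aP a0; rewrite Z_row //; congr (_ * _)%N; apply: eq_card => y.
rewrite !inE -[RHS](inj_eq (mulfI a0)) -(TrZ (b / a * y) aP); congr (_ == Tr _).
by rewrite mulrA mulrCA mulfV // mulr1.
Qed.

Let M_gt0 : (0 < M)%N. Proof. by rewrite expn_gt0 p_gt0. Qed.
Let E_gt0 : (0 < E)%N. Proof. by rewrite expn_gt0 p_gt0. Qed.

Let wt_of_Z a b (n : nat) : Z a b = n -> wt (cw p m u a b) = (p * M ^ 2 - n)%N.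
Proof. by move=> <-; rewrite -(wtZ a b) addnK. Qed.

Lemma wt_zero : wt (cw p m u (0 : F) 0) = 0%N.
Proof.
apply: eq_card0 => xy; rewrite !inE ffunE !mul0r addr0 Tr0.
by case: ifP; rewrite eqxx.
Qed.

Lemma wt_exceptional0 a b : (a, b) \in exceptional [set 0] -> wt (cw p m u a b) = W1.
Proof.
rewrite inE /= => /and3P[aP a0 /imsetP[y]]; rewrite !inE => /eqP Qy fE.
have := Z_scaled b aP a0; rewrite fE.
rewrite (card_meet_level_image polarZ power_formN power_formD) Qy => /wt_of_Z ->.
have [_ A0E] := card_levels.
have le_M : (#|level Q 0%R| <= M)%N by rewrite -A0E leq_addr.
have EM : (M - #|level Q 0%R| = p.-1 * E)%N by rewrite -[X in (X - _)%N]A0E addKn.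
rewrite /W1 -{1}(prednK p_gt0) mulSn addnC -mulnn -addnBA ?leq_mul2l ?le_M ?orbT //.
by rewrite -mulnBr EM [(M * (_ * _))%N]mulnC.
Qed.

Lemma wt_exceptionalN0 a b :
  (a, b) \in exceptional (~: [set 0]) -> wt (cw p m u a b) = W2.
Proof.
rewrite inE /= => /and3P[aP a0 /imsetP[y]]; rewrite !inE => Qy fE.
have := Z_scaled b aP a0; rewrite fE.
rewrite (card_meet_level_image polarZ power_formN power_formD).
rewrite (card_level_scale (power_form_Fp y) Qy) => /wt_of_Z ->.
have [-> _] := card_levels.
by rewrite /W2 -{1}(prednK p_gt0) mulSn mulnDr mulnn subnDl [(M * E)%N]mulnC.
Qed.

(** There are three ways to be generic: [a] outside [Fp]; [a = 0] with [b] nonzero; or [a] in [Fp]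
    nonzero with [b / a] outside the image of [f]. *)
Lemma wt_other a b : (a, b) != (0, 0) -> (a, b) \notin exceptional [set 0] ->
  (a, b) \notin exceptional (~: [set 0]) -> wt (cw p m u a b) = W0.
Proof.
move=> ab0 abN0 abN1; rewrite (wt_of_Z (n := (M ^ 2)%N)).
  by rewrite -{1}(prednK p_gt0) mulSn addKn.
have [aP|] := boolP (a \in Fp); last exact: Z_generic.
have [a0|a0] := eqVneq a 0.
  rewrite a0 xpair_eqE eqxx /= in ab0.
  rewrite Z_row // a0 -mulnn; congr (_ * _)%N; rewrite /M -(card_Tr_mul ab0 Fp0).
  by apply: eq_card => y; rewrite !inE mul0r eq_sym.
rewrite Z_scaled // -mulnn; congr (_ * _)%N.
apply: (card_meet_level_notin_image polarD polarZ polar_adj power_form_Fp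
  power_formN power_formD two_neq0).
apply/imsetP => -[y _ fE]; move: abN0 abN1; rewrite !inE /= (FpP _ aP) eqxx a0 /= fE.
have [Qy|Qy] := eqVneq (Q y) 0.
  by move/negP; case; apply: imset_f; rewrite !inE Qy.
by move=> _ /negP; case; apply: imset_f; rewrite !inE Qy.
Qed.

Lemma card_exceptional (A : {set F}) :
  #|exceptional A| = (p.-1 * #|f @: [set x | Q x \in A]|)%N.
Proof.
rewrite /exceptional (card_pair (fun a b =>
  [&& a \in Fp, a != 0 & b / a \in f @: [set x | Q x \in A]])).
rewrite (bigID (mem (Fp :\ 0))) /= [X in (_ + X)%N]big1 => [|a]; last first.
  rewrite !inE negb_and negbK => aP; apply: eq_card0 => b; rewrite !inE.
  by case/orP: aP => [/eqP->|/negPf->]; rewrite ?eqxx ?andbF.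
rewrite addn0 (eq_bigr (fun=> #|f @: [set x | Q x \in A]|)).
  rewrite sum_nat_const; congr (_ * _)%N.
  by rewrite -card_Fp (cardsD1 0 Fp) Fp0.
move=> a; rewrite !inE => /andP[a0 aP].
rewrite -(card_bij _ (mulfI a0)) -[RHS]cardsE; apply: eq_card => b.
by rewrite !inE aP a0 /= mulrC mulKf.
Qed.

(** * Sizes of the exceptional sets *)

Let U := (p ^ v)%N.
(** This is [p^(s-v-1)] with s = m/2. Writing [M] and [E] through [X] and the kernel order [U ^ 2]
    makes division by that order exact. *)
Let X := (p ^ ((2 * k - 1) * v).-1)%N.

Let U_gt0 : (0 < U ^ 2)%N. Proof. by rewrite !expn_gt0 p_gt0. Qed.
Let kv_ge1 : (0 < (2 * k - 1) * v)%N.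
Proof. by rewrite muln_gt0 v_gt0 andbT; move: k_gt0; clear; lia. Qed.

Let exponentE : ((2 * k + 1) * v = (2 * k - 1) * v + 2 * v)%N.
Proof. by rewrite -mulnDl; congr (_ * _)%N; move: k_gt0; clear; lia. Qed.

Let m_exponentE : (m = 2 * ((2 * k - 1) * v) + 2 * v)%N.
Proof. by rewrite mE mulnA -mulnDl; congr (_ * _)%N; move: k_gt0; clear; lia. Qed.

Let E_X : E = (X * U ^ 2)%N.
Proof.
rewrite /E /X /U -expnM -expnD exponentE; congr (_ ^ _)%N.
by move: kv_ge1; clear; case: (_ * _)%N => // n; lia.
Qed.

Let M_X : M = (p * X ^ 2 * U ^ 2)%N.
Proof.
rewrite /M /X /U -!expnM -expnS -expnD m_exponentE; congr (_ ^ _)%N.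
by move: kv_ge1; clear; case: ((2 * k - 1) * v)%N => // n; lia.
Qed.

(** The level [Q = 0] has [M - p.-1 * E] elements; dividing by the kernel order counts its image.
    The sum form avoids truncated subtraction. *)
Lemma card_exceptional0 :
  (#|exceptional [set 0%R]| + p.-1 * (p.-1 * X) = p.-1 * (p * X ^ 2))%N.
Proof.
rewrite card_exceptional -mulnDr; congr (_ * _)%N; apply/eqP.
rewrite -(eqn_pmul2r U_gt0) mulnDl; apply/eqP.
have := card_image_level polarD power_formN power_formD two_neq0 [set 0].
rewrite card_polar_kernel [(2 * v)%N]mulnC expnM => ->.
rewrite -M_X -mulnA -E_X; case: card_levels => _ <-; congr (_ + _)%N.
by apply: eq_card => x; rewrite !inE.
Qed.

Lemma card_exceptionalN0 :
  #|exceptional (~: [set 0])| = (p.-1 * (p.-1 * (p * X ^ 2 + X)))%N.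
Proof.
rewrite card_exceptional; congr (_ * _)%N; apply/eqP.
rewrite -(eqn_pmul2r U_gt0) -mulnA mulnDl -M_X -E_X; apply/eqP.
have := card_image_level polarD power_formN power_formD two_neq0 (~: [set 0]).
rewrite card_polar_kernel [(2 * v)%N]mulnC expnM => ->.
(* The complement of the zero level consists of [p.-1] levels of size [M + E]. *)
have := sum_card_fibers power_form_Fp; rewrite (bigD1 0) ?Fp0 //=.
rewrite (eq_bigr (fun=> (M + E)%N)) => [|t /andP[tP t0]]; last first.
  by rewrite (card_level_scale tP t0); case: card_levels.
rewrite -[RHS](cardsC [set x | Q x == 0]).
have -> : (\sum_(i in Fp | i != 0%R) (M + E) = p.-1 * (M + E))%N.
  rewrite sum_nat_cond_const; congr (_ * _)%N; rewrite -card_Fp (cardsD1 0 Fp) Fp0.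
  by apply: eq_card => t; rewrite !inE andbC.
by move/addnI->; apply: eq_card => x; rewrite !inE.
Qed.

(** * Injectivity of the encoding and multiplicities *)

Lemma wt_cases a b :
  [\/ a = 0 /\ b = 0 /\ wt (cw p m u a b) = 0%N,
      (a, b) \in exceptional [set 0] /\ wt (cw p m u a b) = W1,
      (a, b) \in exceptional (~: [set 0]) /\ wt (cw p m u a b) = W2 |
      [/\ (a, b) != (0, 0), (a, b) \notin exceptional [set 0],
          (a, b) \notin exceptional (~: [set 0]) & wt (cw p m u a b) = W0]].
Proof.
have [[-> ->]|ab0] := eqVneq (a, b) (0, 0); first by constructor 1; rewrite wt_zero.
have [s0|s0] := boolP ((a, b) \in exceptional [set 0]).
  by constructor 2; rewrite wt_exceptional0.
have [s1|s1] := boolP ((a, b) \in exceptional (~: [set 0])).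
  by constructor 3; rewrite wt_exceptionalN0.
by constructor 4; rewrite wt_other.
Qed.

(** Positivity makes the encoding injective, and strictness keeps the multiplicities of the three
    weights apart. Both rest on [E < M]. *)
Let W_order : (0 < W2 /\ W2 < W0 /\ W0 < W1)%N.
Proof.
have EM : (E < M)%N.
  rewrite E_X M_X ltn_pmul2r // -mulnn mulnCA -[X in (X < _)%N]muln1.
  rewrite ltn_pmul2l ?expn_gt0 ?p_gt0 // (leq_trans p_gt1) // leq_pmulr //.
  by rewrite expn_gt0 p_gt0.
have p1_gt0 : (0 < p.-1)%N by rewrite -ltnS prednK.
have EM_gt0 : (0 < E * M)%N by rewrite muln_gt0 E_gt0.
have lt0 : (E * M < W0)%N.
  by rewrite /W0 -mulnn (leq_trans (n := M * M)) ?ltn_pmul2r // leq_pmull.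
rewrite /W1 /W2 subn_gt0 lt0 ltn_subrL EM_gt0 (leq_trans _ lt0) //.
by rewrite -[X in (X < _)%N]addn0 ltn_add2l !muln_gt0 p1_gt0 E_gt0.
Qed.

Lemma cwB a b a' b' xy : cw p m u (a - a') (b - b') xy =
  cw p m u a b xy - cw p m u a' b' xy.
Proof.
rewrite !ffunE; case: ifP => _; last by rewrite subrr.
by rewrite -TrB; congr (Tr _); ring.
Qed.

(** By linearity a collision yields a codeword of weight 0, which only the pair [(0, 0)] produces.
    Codewords can then be counted as pairs [(a, b)]. *)
Lemma cw_inj : injective (fun ab : F * F => cw p m u ab.1 ab.2).
Proof.
move=> [a b] [a' b'] /= eq_cw.
have wt0 : wt (cw p m u (a - a') (b - b')) = 0%N.
  by apply: eq_card0 => xy; rewrite !inE cwB eq_cw subrr eqxx.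
have [W2_gt0 [W20 W01]] := W_order.
case: (wt_cases (a - a') (b - b')) => [[/eqP + [/eqP + _]]|[_]|[_]|[_ _ _]].
- by rewrite !subr_eq0 => /eqP-> /eqP->.
- by move=> W; move: W01; rewrite -W wt0.
- by move=> W; move: W2_gt0; rewrite -W wt0.
- by move=> W; move: W20; rewrite -W wt0.
Qed.

Lemma card_code : #|code F p m u| = (p ^ m * p ^ m)%N.
Proof. by rewrite /code card_imset; [rewrite card_prod cardF | exact: cw_inj]. Qed.

Lemma multE (n : nat) :
  mult F p m u n%:R = #|[set ab : F * F | wt (cw p m u ab.1 ab.2) == n]|.
Proof.
rewrite -(card_imset _ cw_inj); apply: eq_card => c; rewrite inE.
apply/andP/imsetP => [[/imsetP[ab _ ->]]|[ab]].
  by rewrite eqr_nat => abn; exists ab; rewrite ?inE.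
by rewrite inE => /eqP abn ->; rewrite abn eqxx; split=> //; apply: imset_f.
Qed.

Let W_eqF : ((0%N == W0) = false) * ((0%N == W1) = false) * ((0%N == W2) = false) *
  ((W0 == 0%N) = false) * ((W1 == 0%N) = false) * ((W2 == 0%N) = false) *
  ((W0 == W1) = false) * ((W0 == W2) = false) * ((W1 == W2) = false) *
  ((W1 == W0) = false) * ((W2 == W0) = false) * ((W2 == W1) = false).
Proof.
have [W2_gt0 [W20 W01]] := W_order.
by do !split; apply/eqP; move: W2_gt0 W20 W01; clear; lia.
Qed.

Lemma wt_eq0 a b : (wt (cw p m u a b) == 0%N) = ((a, b) == (0, 0)).
Proof.
case: (wt_cases a b) => [[-> [-> ->]]|[abP ->]|[abP ->]|[/negPf-> _ _ ->]].
- by rewrite !eqxx.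
- rewrite W_eqF; apply/esym/negbTE; apply: contraTneq abP => -[-> ->].
  by rewrite inE /= eqxx andbF.
- rewrite W_eqF; apply/esym/negbTE; apply: contraTneq abP => -[-> ->].
  by rewrite inE /= eqxx andbF.
- by rewrite W_eqF.
Qed.

Lemma wt_eq1 a b : (wt (cw p m u a b) == W1) = ((a, b) \in exceptional [set 0]).
Proof.
have [/wt_exceptional0->|s0] := boolP (_ \in _); first by rewrite eqxx.
by case: (wt_cases a b) => [[_ [_ ->]]|[/(negP s0)]|[_ ->]|[_ _ _ ->]];
  rewrite ?W_eqF.
Qed.

Lemma wt_eq2 a b : (wt (cw p m u a b) == W2) = ((a, b) \in exceptional (~: [set 0])).
Proof.
have [/wt_exceptionalN0->|s0] := boolP (_ \in _); first by rewrite eqxx.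
by case: (wt_cases a b) => [[_ [_ ->]]|[_ ->]|[/(negP s0)]|[_ _ _ ->]];
  rewrite ?W_eqF.
Qed.

Lemma mult_W1 : mult F p m u W1%:R = #|exceptional [set 0]|.
Proof. by rewrite multE; apply: eq_card => -[a b]; rewrite inE wt_eq1. Qed.

Lemma mult_W2 : mult F p m u W2%:R = #|exceptional (~: [set 0])|.
Proof. by rewrite multE; apply: eq_card => -[a b]; rewrite inE wt_eq2. Qed.

Lemma mult_0 : mult F p m u 0 = 1%N.
Proof.
rewrite -[0]/(0%:R) multE -(cards1 ((0, 0) : F * F)).
by apply: eq_card => -[a b]; rewrite !inE wt_eq0.
Qed.

(** The generic weight is counted last, as what the other classes leave of all pairs [(a, b)]. *)
Lemma mult_W0 : (mult F p m u W0%:R + #|exceptional [set 0%R]| +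
  #|exceptional (~: [set 0%R])| + 1 = p ^ m * p ^ m)%N.
Proof.
suff : (mult F p m u W0%:R + mult F p m u W1%:R + mult F p m u W2%:R +
         mult F p m u 0%:R = p ^ m * p ^ m)%N by rewrite mult_W1 mult_W2 mult_0.
rewrite !multE !card_eq_sum.
rewrite -cardF -card_prod -sum1_card -!big_split /=; apply: eq_bigr => -[a b] _ /=.
by case: (wt_cases a b) => [[_ [_ ->]]|[_ ->]|[_ ->]|[_ _ _ ->]]; rewrite eqxx !W_eqF.
Qed.

Let natr_pred : ((p - 1)%N%:R : rat) = p%:R - 1.
Proof. by rewrite natrB. Qed.

Let pX : (p * X = p ^ ((2 * k - 1) * v))%N.
Proof. by rewrite /X -expnS prednK. Qed.

Let half_m : ((m %/ 2) - v = (2 * k - 1) * v)%N.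
Proof. by rewrite m_exponentE -mulnDr mulKn // addnK. Qed.

Lemma weight_distribution :
  let s := (m %/ 2)%N in
  let w0 : rat := ((p - 1) * p ^ (2 * m - 2))%:R in
  let w1 : rat := w0 * (1 + (p%:R ^+ (s - v))^-1) in
  let w2 : rat := w0 * (1 - ((p - 1)%:R * p%:R ^+ (s - v))^-1) in
  #|@D1 F p m u| = (p ^ (2 * m - 1) - 1)%N /\
  #|code F p m u| = (p ^ (2 * m))%N /\
  (forall c, c \in code F p m u ->
     [\/ wt c = 0%N, (wt c)%:R = w0, (wt c)%:R = w1 | (wt c)%:R = w2]) /\
  mult F p m u 0 = 1%N /\
  (mult F p m u w0)%:R = (p%:R ^+ (2 * m) - 1 - (p%:R - 1) * p%:R ^+ (m - 2 * v) : rat) /\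
  (mult F p m u w1)%:R = ((p%:R - 1) * (p%:R ^+ (m - 2 * v - 1) - p%:R ^+ (s - v)
                                        + p%:R ^+ (s - v - 1)) : rat) /\
  (mult F p m u w2)%:R = ((p%:R - 1) * (p%:R ^+ (s - v) + 1)
                          * (p%:R ^+ (s - v) - p%:R ^+ (s - v - 1)) : rat).
Proof.
move=> s w0 w1 w2.
have p_neq0 : p%:R != 0 :> rat by rewrite pnatr_eq0 -lt0n.
have p1_neq0 : p%:R - 1 != 0 :> rat.
  by rewrite -natr_pred pnatr_eq0 -lt0n subn_gt0.
have X_neq0 : X%:R != 0 :> rat by rewrite pnatr_eq0 -lt0n expn_gt0 p_gt0.
have U_neq0 : U%:R != 0 :> rat by rewrite pnatr_eq0 -lt0n expn_gt0 p_gt0.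
(* All powers are rewritten as monomials in [p], [X] and [U], so that the claims become identities
   of rational functions. *)
have pr : p%:R ^+ (s - v) = p%:R * X%:R :> rat.
  by rewrite -natrX -natrM pX /s half_m.
have pr1 : p%:R ^+ (s - v - 1) = X%:R :> rat by rewrite -natrX /s half_m subn1.
have m2v : (m - 2 * v = 2 * ((2 * k - 1) * v))%N by rewrite {1}m_exponentE addnK.
have pm2v : p%:R ^+ (m - 2 * v) = p%:R ^+ 2 * X%:R ^+ 2 :> rat.
  by rewrite m2v mulnC exprM -exprMn -natrM pX natrX.
have pm2v1 : p%:R ^+ (m - 2 * v - 1) = p%:R * X%:R ^+ 2 :> rat.
  have : (0 < m - 2 * v)%N by rewrite m2v muln_gt0.
  move=> m2v_gt0; apply: (mulfI p_neq0).
  by rewrite -exprS subn1 prednK // pm2v; ring.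
have mm1 : (2 * m - 2 = m.-1 * 2)%N by rewrite -subn1 mulnBl mulnC.
have M_rat : M%:R = p%:R * X%:R ^+ 2 * U%:R ^+ 2 :> rat.
  by rewrite M_X !natrM !natrX.
have E_rat : E%:R = X%:R * U%:R ^+ 2 :> rat by rewrite E_X !natrM natrX.
have w0E : w0 = W0%:R by rewrite /w0 /W0 mm1 expnM subn1.
have W0_rat : W0%:R = (p%:R - 1) * M%:R ^+ 2 :> rat.
  by rewrite /W0 -subn1 natrM natrX natr_pred.
have w1E : w1 = W1%:R.
  rewrite /w1 w0E pr natrD -/W0 natrM natrM -subn1 natr_pred W0_rat E_rat M_rat.
  by field; rewrite ?p_neq0 ?X_neq0 ?p1_neq0.
have w2E : w2 = W2%:R.
  have [W2_gt0 _] := W_order; have EM_le : (E * M <= W0)%N.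
    by rewrite ltnW // -subn_gt0.
  rewrite /w2 w0E pr natr_pred /W2 (natrB _ EM_le) natrM W0_rat E_rat M_rat.
  by field; rewrite ?p_neq0 ?X_neq0 ?p1_neq0.
have card0 : (#|exceptional [set 0]|)%:R =
    (p%:R - 1) * (p%:R * X%:R ^+ 2 - (p%:R - 1) * X%:R) :> rat.
  have /(congr1 (fun n => n%:R : rat)) := card_exceptional0.
  rewrite natrD !natrM natrX -subn1 natr_pred => /(canRL (addrK _)) ->; ring.
have cardN0 : (#|exceptional (~: [set 0])|)%:R =
    (p%:R - 1) * ((p%:R - 1) * (p%:R * X%:R ^+ 2 + X%:R)) :> rat.
  by rewrite card_exceptionalN0 !natrM natrD natrM natrX -subn1 natr_pred.
rewrite w0E w1E w2E; split; [|split; [|split; [|split; [|split; [|split]]]]].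
- rewrite card_D1 -subn1 /M -expnM -expnS; congr (_ ^ _ - _)%N.
  by move: m_gt0; clear; lia.
- by rewrite card_code -expnD addnn mul2n.
- move=> c /imsetP[[a b] _ ->] /=.
  case: (wt_cases a b) => [[_ [_ ->]]|[_ ->]|[_ ->]|[_ _ _ ->]].
  + by constructor 1.
  + by constructor 3.
  + by constructor 4.
  + by constructor 2.
- exact: mult_0.
- have /(congr1 (fun n => n%:R : rat)) := mult_W0.
  rewrite !natrD card0 cardN0 -expnD addnn -mul2n natrX pm2v => <-.
  ring.
- by rewrite mult_W1 card0 pr pr1 pm2v1; ring.
- by rewrite mult_W2 cardN0 pr pr1; ring.
Qed.

End PowerForm.
End Trace.

Theorem theorem4 (F : finFieldType) (p m u : nat) :
  prime p -> odd p -> (p \in [pchar F])%N -> #|F| = (p ^ m)%N ->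
  (0 < m)%N -> ~~ odd m -> (0 < u)%N ->
  let s := (m %/ 2)%N in
  let v := gcdn m u in
  ((m %/ v) %% 4 = 0)%N ->
  let w0 : rat := ((p - 1) * p ^ (2 * m - 2))%:R in
  let w1 : rat := w0 * (1 + (p%:R ^+ (s - v))^-1) in
  let w2 : rat := w0 * (1 - ((p - 1)%:R * p%:R ^+ (s - v))^-1) in
  (* length and dimension: [p^(2m-1) - 1, 2m] *)
  #|@D1 F p m u| = (p ^ (2 * m - 1) - 1)%N /\
  #|code F p m u| = (p ^ (2 * m))%N /\
  (* exactly the weights 0, w0, w1, w2 occur *)
  (forall c, c \in code F p m u ->
     [\/ wt c = 0%N, (wt c)%:R = w0, (wt c)%:R = w1 | (wt c)%:R = w2]) /\
  (* weight distribution *)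
  mult F p m u 0 = 1%N /\
  (mult F p m u w0)%:R = (p%:R ^+ (2 * m) - 1 - (p%:R - 1) * p%:R ^+ (m - 2 * v) : rat) /\
  (mult F p m u w1)%:R = ((p%:R - 1) * (p%:R ^+ (m - 2 * v - 1) - p%:R ^+ (s - v)
                                        + p%:R ^+ (s - v - 1)) : rat) /\
  (mult F p m u w2)%:R = ((p%:R - 1) * (p%:R ^+ (s - v) + 1)
                          * (p%:R ^+ (s - v) - p%:R ^+ (s - v - 1)) : rat).
Proof.
move=> pr_p p_odd charF cardF m_gt0 _ u_gt0 s v m_mod4.
have v_gt0 : (0 < v)%N by rewrite gcdn_gt0 m_gt0.
have /dvdnP[w uE] : (v %| u)%N := dvdn_gcdr m u.
have /dvdnP[n mE] : (v %| m)%N := dvdn_gcdl m u.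
rewrite mE mulnK // in m_mod4.
have /dvdnP[k nE] : (4 %| n)%N by rewrite /dvdn m_mod4.
have mE' : m = (4 * k * v)%N by rewrite mE nE [(k * 4)%N]mulnC.
have k_gt0 : (0 < k)%N.
  by rewrite lt0n; apply: contraTneq m_gt0 => k0; rewrite mE' k0 muln0.
apply: (@weight_distribution F p m pr_p charF cardF m_gt0 u v k w) => //.
(* Multiplied by [v], the coprimality of the cofactors becomes the definition of [v] as a gcd. *)
rewrite [(4 * k)%N]mulnC -nE /coprime -(eqn_pmul2r v_gt0) muln_gcdl -mE -uE.
by rewrite gcdnC mul1n.
Qed.
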